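(* A poset $(P,\leq)$ is isomorphic to $P(M,M)$ for a finitely generated pointed submonoid $M$ of an abelian group if and only if $P$ is auto-equivalent, locally finite, and has a finite number of atoms.
   Context: For a monoid $M$, $P(M,M)$ denotes $M$ with the relation $x\leq_M y :\iff \exists m\in M:\ xm=y$ (when this is a partial order). A submonoid $M$ of a group with neutral element $e$ is pointed if $M\cap M^{-1}=\{e\}$; for such $M$ the relation $\leq_M$ is a partial order. $\mathrm{End}(P)$ is the monoid of order-preserving self-maps of $P$ under composition, and $\uparrow\! x=\{y\in P\mid x\leq y\}$. A poset $P$ is auto-equivalent if it has a global minimum and there exists a commutative submonoid $T<\mathrm{End}(P)$ such that for every $x\in P$ there exists a unique $\varphi_x\in T$ such that $\varphi_x(P)=\,\uparrow\! x$ and $\varphi_x:P\to\,\uparrow\! x$ is an order isomorphism. $P$ is locally finite if for all $x,y\in P$ the interval $[x,y]=\{z\in P\mid x\leq z\leq y\}$ is finite. The atoms of a poset $P$ with global minimum $e$ are the minimal elements of $P\setminus\{e\}$. *)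

(* Defs.v *)
From mathcomp Require Import all_boot all_order all_algebra.
From mathcomp Require Import boolp classical_sets functions cardinality.
From mathcomp Require Import set_interval.

Set Implicit Arguments.
Unset Strict Implicit.
Unset Printing Implicit Defensive.

Import Order.TTheory GRing.Theory.
Local Open Scope classical_set_scope.

Section Monoids.
Local Open Scope ring_scope.
Variable G : zmodType.
Implicit Types M S : set G.

Definition submonoid M := M 0 /\ forall x y, M x -> M y -> M (x + y).

Definition submonoid_closure S : set G := smallest submonoid S.

Definition finitely_generated M :=
  exists2 S : set G, finite_set S & M = submonoid_closure S.

Definition pointed M := M `&` [set - x | x in M] = [set 0].

(* The relation of P(M, M); its carrier is the type of elements of M. *)
Definition divides M (x y : M) : Prop := exists m : M, val x + val m = val y.

End Monoids.

Section Posets.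
Local Open Scope order_scope.
Context {d : Order.disp_t}.
Implicit Types P : porderType d.

Definition isomorphic_to_P (P : porderType d) (G : zmodType) (M : set G) :=
  exists2 f : P -> M, bijective f & forall x y, x <= y <-> divides (f x) (f y).

Definition order_endo P : set (P -> P) := [set f | {homo f : x y / x <= y}].

Definition commutative_submonoid_endo P (T : set (P -> P)) :=
  [/\ T `<=` @order_endo P, T idfun,
      forall f g, T f -> T g -> T (f \o g)
    & forall f g, T f -> T g -> f \o g = g \o f].

Definition order_iso_onto P (A : set P) (f : P -> P) :=
  set_bij [set: P] A f /\ {mono f : x y / x <= y}.

Definition global_minimum P (e : P) := forall x, e <= x.

Definition auto_equivalent P :=
  (exists e : P, global_minimum e) /\
  exists T : set (P -> P), commutative_submonoid_endo T /\
    forall x : P, exists! phi : P -> P,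
      [/\ T phi, range phi = `[x, +oo[%classic
        & order_iso_onto `[x, +oo[%classic phi].

Definition locally_finite P := forall x y : P, finite_set `[x, y]%classic.

Definition minimal_elements P (A : set P) : set P :=
  [set a | A a /\ forall b, A b -> b <= a -> b = a].

Definition atoms P (e : P) : set P := minimal_elements (~` [set e]).

Definition finitely_many_atoms P :=
  exists2 e : P, global_minimum e & finite_set (atoms e).

End Posets.

(* Main.v *)
Require Import Defs.
From HB Require Import structures.
From mathcomp Require Import all_boot all_order all_algebra.
From mathcomp Require Import generic_quotient.
From mathcomp Require Import boolp classical_sets functions cardinality.

(** The partial orders [P(M, M)] are the posets on which a commutative
cancellative monoid law [+] without nonzero invertible elements makes
[x <= y] mean that [y = x + m] for some [m].

From left to right, the translations of [M] form the commutative monoid of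
endomorphisms asked for by auto-equivalence, and an atom is one of the
generators.  For local finiteness the key point is Dickson's lemma, proved here
for any finitely generated submonoid of an abelian group ([dickson]): each
subset [A] contains a finite subset [F], a basis of [A], such that every
element of [A] is above an element of [F].
The interval [[0, y]] of [M] is anti-isomorphic to itself by
[z |-> y - z], so by Dickson's lemma each of its nonempty subsets has a maximal
element.  If some [[z, y]] were infinite, there would be a maximal such [z];
but [[z, y]] is the union of [{z}] and of the [[w, y]] for [w] in a finite
Dickson basis of the elements [w] with [z < w <= y], each of these intervals
being finite by maximality of [z] ([finite_divisors]).

From right to left, if [phi_x] is the unique member of [T] that maps [P]
isomorphically onto the up-set of [x], then [x + y := phi_x y] is a
commutative monoid law: [phi_x \o phi_y] belongs to [T] and maps [P] onto the
up-set of [phi_x y], so that it is [phi_(x + y)].  It is cancellative because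
[phi_x] is injective, hence [P] embeds into its Grothendieck group
([embed_inj]).  Finally the atoms generate [P]: a non-minimum [x] is above some
atom [a], so that [x = a + y] with [y < x], and local finiteness allows an
induction along [<] ([locally_finite_ind]). *)

Set Implicit Arguments.
Unset Strict Implicit.
Unset Printing Implicit Defensive.

Import Order.TTheory GRing.Theory.
Local Open Scope classical_set_scope.
Local Open Scope ring_scope.

(** * The Grothendieck group of a commutative monoid *)

Section Grothendieck.
Local Open Scope quotient_scope.
Variable N : nmodType.
Implicit Types (a b c k : N) (p q : N * N).

(** The pairs [(a, b)] and [(c, d)] represent the same formal difference; the
extra summand [k] makes the relation transitive without cancellation. *)
Definition same_diff p q : bool :=
  `[< exists k, p.1 + q.2 + k = q.1 + p.2 + k >].

Lemma same_diff_equiv : equiv_class_of same_diff.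
Proof.
split=> [p|p q|q p r].
- by apply/asboolP; exists 0.
- by apply/asboolP/asboolP => -[k E]; exists k.
move=> /asboolP[k Ek] /asboolP[l El]; apply/asboolP.
exists (q.1 + q.2 + k + l).
have -> : p.1 + r.2 + (q.1 + q.2 + k + l) = (p.1 + q.2 + k) + (q.1 + r.2 + l).
  by rewrite (AC (2*4) ((1*4*5)*(3*2*6))).
by rewrite Ek El (AC (3*3) ((4*2)*(1*5*3*6))).
Qed.

Canonical same_diff_equivRel := EquivRelPack same_diff_equiv.

(** The Grothendieck group of [N], of formal differences of elements of [N]. *)
Definition grothendieck := {eq_quot same_diff_equivRel}.
HB.instance Definition _ := Choice.on grothendieck.

Definition formal_diff a b : grothendieck := \pi_grothendieck (a, b).

Lemma formal_diffP a b c d :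
  formal_diff a b = formal_diff c d <-> exists k, a + d + k = c + b + k.
Proof.
split=> [/eqmodP|E]; first by move=> /asboolP.
by apply/eqmodP/asboolP.
Qed.

Lemma formal_diff_surj x : exists a b, x = formal_diff a b.
Proof.
exists (repr x).1, (repr x).2.
by rewrite /formal_diff -surjective_pairing reprK.
Qed.

(** The group operations are computed on chosen representatives. *)
Definition groth_add (x y : grothendieck) :=
  formal_diff ((repr x).1 + (repr y).1) ((repr x).2 + (repr y).2).
Definition groth_opp (x : grothendieck) := formal_diff (repr x).2 (repr x).1.

Lemma repr_formal_diff a b :
  exists k, (repr (formal_diff a b)).1 + b + k
            = a + (repr (formal_diff a b)).2 + k.
Proof.
by apply/formal_diffP; rewrite /formal_diff -surjective_pairing reprK.
Qed.

Lemma groth_addE a b c d :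
  groth_add (formal_diff a b) (formal_diff c d) = formal_diff (a + c) (b + d).
Proof.
apply/formal_diffP.
have [k Ek] := repr_formal_diff a b; have [l El] := repr_formal_diff c d.
exists (k + l).
move: (repr (formal_diff a b)) (repr (formal_diff c d)) Ek El.
move=> [p p'] [q q'] /= Ek El.
rewrite /= (AC (2*2*2) ((1*3*5)*(2*4*6))).
by rewrite /= Ek El (AC (3*3) ((1*4)*(2*5)*(3*6))).
Qed.

Lemma groth_oppE a b : groth_opp (formal_diff a b) = formal_diff b a.
Proof.
apply/formal_diffP; have [k Ek] := repr_formal_diff a b; exists k.
by rewrite addrC [RHS]addrC addrC [_ + a]addrC -Ek addrC [b + _]addrC addrC.
Qed.

Lemma groth_addA : associative groth_add.
Proof.
move=> x y z; have [a [b ->]] := formal_diff_surj x.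
have [c [d ->]] := formal_diff_surj y; have [u [v ->]] := formal_diff_surj z.
by rewrite !groth_addE !addrA.
Qed.

Lemma groth_addC : commutative groth_add.
Proof. by move=> x y; rewrite /groth_add addrC [X in formal_diff _ X]addrC. Qed.

Lemma groth_add0 : left_id (formal_diff 0 0) groth_add.
Proof.
by move=> x; have [a [b ->]] := formal_diff_surj x; rewrite groth_addE !add0r.
Qed.

Lemma groth_addN : left_inverse (formal_diff 0 0) groth_opp groth_add.
Proof.
move=> x; have [a [b ->]] := formal_diff_surj x; rewrite groth_oppE groth_addE.
by apply/formal_diffP; exists 0; rewrite !addr0 add0r addrC.
Qed.

HB.instance Definition _ := GRing.isZmodule.Build grothendieck
  groth_addA groth_addC groth_add0 groth_addN.

(** The canonical map from [N] to its Grothendieck group. *)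
Definition embed a : grothendieck := formal_diff a 0.

Lemma embed0 : embed 0 = 0.
Proof. by []. Qed.

Lemma embedD a b : embed (a + b) = embed a + embed b.
Proof. by rewrite /GRing.add/= groth_addE addr0. Qed.

Lemma embed_inj : right_injective (@GRing.add N) -> injective embed.
Proof.
move=> addI a b /formal_diffP[k].
by rewrite !addr0 addrC [RHS]addrC; apply: addI.
Qed.

End Grothendieck.

(** * Dickson's lemma in finitely generated submonoids *)

Section Dickson.
Variable G : zmodType.
Implicit Types (M : set G) (l : seq G).

(** Linear combinations of the elements of [l] with coefficients in [nat]. *)
Fixpoint nat_span l : set G :=
  if l is s :: l' then [set x | exists j m, nat_span l' m /\ x = s *+ j + m]
  else [set 0].

Lemma nat_span_submonoid l : submonoid (nat_span l).
Proof.
elim: l => [|s l [IH0 IHD]]; first by split=> // x y -> ->; rewrite /= addr0.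
split=> [|_ _ [j [m [lm ->]]] [k [n [ln ->]]]].
  by exists 0%N, 0; rewrite mulr0n addr0.
by exists (j + k)%N, (m + n); rewrite mulrnDr addrACA; split=> //; apply: IHD.
Qed.

Lemma mem_nat_span l x : x \in l -> nat_span l x.
Proof.
elim: l => //= s l IH; rewrite inE => /predU1P[->|/IH lx].
  exists 1%N, 0; rewrite mulr1n addr0; split=> //.
  by case: (nat_span_submonoid l).
by exists 0%N, x; rewrite mulr0n add0r.
Qed.

Lemma nat_span_min M l :
  submonoid M -> (forall x, x \in l -> M x) -> nat_span l `<=` M.
Proof.
move=> [M0 MD]; elim: l => [|s l IH] lM /=; first by move=> _ ->.
move=> _ [j [m [lm ->]]]; apply: (MD); last first.
  by apply: IH lm => x lx; apply: lM; rewrite inE lx orbT.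
elim: j => [|j IHj]; first by rewrite mulr0n.
by rewrite mulrS; apply: MD => //; apply: lM; rewrite inE eqxx.
Qed.

Lemma submonoid_closureE l : submonoid_closure [set` l] = nat_span l.
Proof.
apply/seteqP; split.
  by apply: smallest_sub; [exact: nat_span_submonoid | exact: mem_nat_span].
by move=> x lx M [sM lM]; apply: nat_span_min lx.
Qed.

Lemma nat_span_neq0 l m : nat_span l m -> m <> 0 ->
  exists2 s, s \in l & s <> 0 /\ exists2 k, nat_span l k & m = s + k.
Proof.
elim: l m => //= s l IH _ [j [m [lm ->]]] nz.
have [sj0|sj] := pselect (s *+ j = 0).
  move: nz; rewrite sj0 add0r => /(IH _ lm)[t lt [t0 [k lk mE]]].
  exists t; first by rewrite inE lt orbT.
  by split=> //; exists k => //; exists 0%N, k; rewrite mulr0n add0r.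
exists s; first by rewrite inE eqxx.
case: j sj {nz} => [/(_ (mulr0n s))//|j] sj.
split=> [s0|]; first by apply: sj; rewrite s0 mul0rn.
by exists (s *+ j + m); [exists j, m | rewrite mulrS addrA].
Qed.

(** The induction on [l] cuts [A] along the multiples [s *+ j] of the first
generator: a basis of the union of the slices, lifted to [A], takes care of all
large [j], and finitely many slices remain. *)
Lemma dickson l (A : set G) : A `<=` nat_span l ->
  exists F : set G, [/\ finite_set F, F `<=` A &
    forall a, A a -> exists f m, [/\ F f, nat_span l m & a = f + m]].
Proof.
elim: l A => [|s l IH] A Al.
  exists A; split=> //; first by apply: sub_finite_set Al _; exact: finite_set1.
  by move=> a Aa; exists a, 0; rewrite addr0.
have [l0 lD] := nat_span_submonoid l.
(* The slices of A along the multiples of s, and their union. *)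
pose slice j := [set m | nat_span l m /\ A (s *+ j + m)].
have /IH[F' [finF' F'A F'B]] : \bigcup_j slice j `<=` nat_span l.
  by move=> m [j _ []].
have /choice[h hP] f : exists j, F' f -> slice j f.
  have [/F'A[j _ fj]|nF'f] := pselect (F' f); first by exists j.
  by exists 0%N => /nF'f.
have /choice[B BP] j : exists F : set G, [/\ finite_set F, F `<=` slice j &
    forall a, slice j a -> exists f m, [/\ F f, nat_span l m & a = f + m]].
  by apply: IH => m [].
(* A bound n on the lifts to A of the elements of F'. *)
have [n hn] : exists n, forall f, F' f -> (h f <= n)%N.
  have /finite_seqP[r F'r] := finF'.
  exists (\max_(f <- r) h f)%N => f; rewrite F'r /= => rf.
  exact: (leq_bigmax_seq (F := h)).
exists ([set s *+ h f + f | f in F'] `|`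
        \bigcup_(j in `I_n) [set s *+ j + f | f in B j]); split.
- rewrite finite_setU; split; first exact: finite_image.
  apply: bigcup_finite => [|j _]; first exact: finite_II.
  by apply: finite_image; case: (BP j).
- move=> _ [[f F'f <-]|[j _ [f Bf <-]]]; first by case: (hP f F'f).
  by have [_ /(_ _ Bf)[]] := BP j.
move=> a Aa; have [j [m [lm aE]]] := Al a Aa.
have [jn|nj] := ltnP j n.
  have [_ _ /(_ m)[|f [k [Bf lk mE]]]] := BP j; first by rewrite /slice /= -aE.
  exists (s *+ j + f), k; split; [by right; exists j => //; exists f | |].
    by exists 0%N, k; rewrite mulr0n add0r.
  by rewrite aE mE addrA.
have [|f [k [F'f lk mE]]] := F'B m.
  by exists j => //; rewrite /slice /= -aE.
exists (s *+ h f + f), (s *+ (j - h f) + k); split; [by left; exists f | |].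
  by exists (j - h f)%N, k.
have hj : (h f <= j)%N by apply: leq_trans nj; apply: hn.
by rewrite addrACA -mulrnDr subnKC // -mE.
Qed.

(** When divisibility is antisymmetric, a minimal element of a Dickson basis of
[A] is minimal in [A]. *)
Lemma dickson_minimal l (A : set G) :
  (forall x y, nat_span l x -> nat_span l y -> x + y = 0 -> x = 0) ->
  A `<=` nat_span l -> A !=set0 ->
  exists2 a, A a & forall b m, A b -> nat_span l m -> a = b + m -> m = 0.
Proof.
move=> ptd Al [a0 Aa0].
have [l0 lD] := nat_span_submonoid l.
have [F [/finite_seqP[r Fr] FA FB]] := dickson Al.
have [f0 [m0 [Ff0 _ _]]] := FB a0 Aa0.
suff [f Ff fmin] : exists2 f, F f &
    forall b m, F b -> nat_span l m -> f = b + m -> m = 0.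
  exists f => [|b m Ab lm fE]; first exact: FA.
  have [g [k [Fg lk bE]]] := FB b Ab.
  have /(fmin g) : nat_span l (m + k) by apply: lD.
  rewrite fE {1}bE -addrA [k + m]addrC => /(_ Fg erefl).
  exact: ptd.
(* A minimal element of the finite nonempty set F. *)
have rf0 : f0 \in r by move: Ff0; rewrite Fr.
rewrite {}Fr {FA FB Ff0} /=.
elim: r f0 rf0 => // s r IH f0 _.
have [r0|[t rt]] : r = [::] \/ exists t, t \in r.
  by case: (r) => [|t r']; [left | right; exists t; rewrite inE eqxx].
  exists s => [|b m]; first by rewrite inE eqxx.
  rewrite r0 inE => /eqP -> _ /eqP.
  by rewrite -subr_eq0 opprD addNKr oppr_eq0 => /eqP.
have [f rf fmin] := IH t rt.
have [|nsf] := pselect (exists2 k, nat_span l k & f = s + k); last first.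
  exists f => [|b m]; first by rewrite inE rf orbT.
  rewrite inE => /predU1P[->|rb] lm fE; last exact: fmin rb lm fE.
  by case: nsf; exists m.
move=> [k lk fE]; exists s => [|b m]; first by rewrite inE eqxx.
rewrite inE => /predU1P[-> _ /eqP|rb lm sE].
  by rewrite -subr_eq0 opprD addNKr oppr_eq0 => /eqP.
have := fmin b (m + k) rb (lD _ _ lm lk).
by rewrite addrA -sE => /(_ fE); apply: ptd.
Qed.

(** An element of a finitely generated pointed monoid has finitely many
divisors. *)
Lemma finite_divisors l y :
  (forall x y, nat_span l x -> nat_span l y -> x + y = 0 -> x = 0) ->
  finite_set [set z | nat_span l z /\ nat_span l (y - z)].
Proof.
move=> ptd; have [l0 lD] := nat_span_submonoid l.
pose I z := [set w | nat_span l (w - z) /\ nat_span l (y - w)].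
have -> : [set z | nat_span l z /\ nat_span l (y - z)] = I 0.
  by apply/seteqP; split=> w; rewrite /I /= subr0.
apply: contrapT => infI.
(* A minimal c with [y - c, y] infinite gives a maximal z := y - c. *)
pose C := [set c | nat_span l c /\ ~ finite_set (I (y - c))].
have [|c [lc infc] cmin] := @dickson_minimal l C ptd (fun c => @proj1 _ _).
  exists y; split; last by rewrite subrr.
  (* If y is not in the monoid, it has no divisors. *)
  apply: contrapT => nly; apply: infI.
  rewrite (_ : I 0 = set0) //; apply/seteqP; split=> // w [lw lyw].
  by apply: nly; rewrite -(subrK w y); apply: lD => //; rewrite -[w]subr0.
apply: infc; set z := y - c.
(* The elements w of the interval with z < w, translated by -z. *)
pose A := [set u | [/\ nat_span l u, u <> 0 & nat_span l (c - u)]].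
have [|F [finF FA FB]] := @dickson l A; first by move=> u [].
apply: (@sub_finite_set _ _ ([set z] `|` \bigcup_(f in F) I (z + f))).
  move=> w [lwz lyw]; have [->|/eqP wz] := eqVneq w z; first by left.
  have [|f [m [Ff lm wE]]] := FB (w - z).
    split=> //; first by move/eqP; rewrite subr_eq0 => /eqP.
    by rewrite opprB addrA /z subrKC.
  by right; exists f => //; split=> //; rewrite opprD addrA wE addrC addKr.
rewrite finite_setU; split; first exact: finite_set1.
apply: bigcup_finite => // f /FA[lf f0 lcf]; apply: contrapT => inff.
(* By minimality of c, the interval [y - (c - f), y] is finite. *)
apply: f0; apply: (cmin (c - f)) => //; last by rewrite subrK.
by split=> //; rewrite opprB addrCA addrC.
Qed.

End Dickson.

(** * Posets of divisibility *)

(** Isomorphisms onto [P(M, M)] as injections into the ambient group, which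
avoid the subtype of the elements of [M]. *)
Lemma isomorphic_to_PP (d : Order.disp_t) (P : porderType d) (G : zmodType)
    (M : set G) :
  isomorphic_to_P P M <->
  exists g : P -> G, [/\ injective g, range g = M
    & forall x y, (x <= y)%O <-> exists2 m, M m & g x + m = g y].
Proof.
split=> [[f [h fK hK] fle]|[g [ginj gM gle]]].
  exists (fun x => val (f x)); split.
  - exact: inj_comp val_inj (can_inj fK).
  - apply/seteqP; split=> [_ [x _ <-]|m Mm]; first exact: set_valP.
    by exists (h (SigSub (mem_set Mm))) => //; rewrite hK.
  move=> x y; rewrite fle; split=> [[m mE]|[m Mm mE]].
    by exists (val m) => //; exact: set_valP.
  by exists (SigSub (mem_set Mm)).
have gMx x : g x \in M by apply/mem_set; rewrite -gM; exists x.
have /choice[h hP] (m : M) : exists x, g x = val m.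
  by have := set_valP m; rewrite -{1}gM => -[x _ <-]; exists x.
exists (fun x => SigSub (gMx x) : M); first exists h.
- by move=> x; apply: ginj; rewrite hP.
- by move=> m; apply: val_inj; rewrite /= hP.
move=> x y; rewrite gle; split=> [[m Mm mE]|[m mE]].
  by exists (SigSub (mem_set Mm)).
by exists (val m) => //; exact: set_valP.
Qed.

Lemma pointedP (G : zmodType) (M : set G) : submonoid M ->
  pointed M <-> forall x y, M x -> M y -> x + y = 0 -> x = 0.
Proof.
move=> [M0 _]; split=> [ptd x y Mx My xy|ptd].
  suff : [set 0] x by [].
  rewrite -ptd; split=> //; exists y => //.
  by apply/eqP; rewrite eq_sym -addr_eq0 xy.
apply/seteqP; split=> [x [Mx [y My yx]]|_ ->].
  by apply: (ptd x y) => //; rewrite -yx addNr.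
by split=> //; exists 0 => //; rewrite oppr0.
Qed.

Section FromMonoid.
Context (d : Order.disp_t) (P : porderType d) (G : zmodType).
Variables (M : set G) (g : P -> G).
Hypotheses (subM : submonoid M) (g_inj : injective g) (g_range : range g = M).
Hypothesis g_le : forall x y, (x <= y)%O <-> exists2 m, M m & g x + m = g y.

Let gM x : M (g x). Proof. by rewrite -g_range; exists x. Qed.

Let gP m : M m -> exists x, g x = m.
Proof. by rewrite -{1}g_range => -[x _ <-]; exists x. Qed.

Lemma le_divides x y : (x <= y)%O <-> M (g y - g x).
Proof.
rewrite g_le; split=> [[m Mm <-]|Myx]; first by rewrite addrC addKr.
by exists (g y - g x) => //; rewrite subrKC.
Qed.

Lemma divides_minimum e : g e = 0 -> @global_minimum d P e.
Proof. by move=> ge x; rewrite le_divides ge subr0. Qed.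

Lemma divides_auto_equivalent : auto_equivalent P.
Proof.
have [M0 MD] := subM; have [e ge] := gP M0.
split; first by exists e; apply: divides_minimum.
have /choice[t tE] (p : P * P) : exists x, g x = g p.1 + g p.2.
  by apply: gP; apply: MD.
(* Translation by z, transported to P. *)
pose tau z x := t (z, x).
have gtau z x : g (tau z x) = g z + g x by exact: tE.
have tau_mono z : {mono tau z : x y / (x <= y)%O}.
  move=> x y; apply/idP/idP;
    by rewrite !le_divides !gtau opprD addrACA subrr add0r.
have tau_range z : range (tau z) = [set x | (z <= x)%O].
  apply/seteqP; split=> [_ [x _ <-]|y /= /g_le[m /gP[x <-] E]].
    by rewrite /= g_le; exists (g x).
  by exists x => //; apply: g_inj; rewrite gtau.
exists (range tau); split.
  split.
  - by move=> _ [z _ <-] x y xy; rewrite tau_mono.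
  - exists e => //; apply/funext => x; apply: g_inj.
    by rewrite gtau ge add0r.
  - move=> _ _ [z _ <-] [w _ <-]; exists (tau z w) => //; apply/funext => x.
    by apply: g_inj; rewrite /= !gtau addrA.
  - move=> _ _ [z _ <-] [w _ <-]; apply/funext => x.
    by apply: g_inj; rewrite /= !gtau addrCA.
have itvE z : `[z, +oo[%classic = [set x | (z <= x)%O].
  by apply/seteqP; split=> x; rewrite /= in_itv /= andbT.
move=> z; exists (tau z); split.
  rewrite itvE; split=> //; split=> //; split.
  - by move=> x _; rewrite -tau_range; exists x.
  - by move=> x y _ _ /(congr1 g); rewrite !gtau => /addrI; exact: g_inj.
  - by rewrite -tau_range.
(* A translation is determined by the least element of its range. *)
move=> _ [[w _ <-] + _]; rewrite itvE tau_range => wz.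
congr tau; apply: le_anti; apply/andP; split.
  by move/seteqP: wz => [+ _] => /(_ w); apply; exact: lexx.
by move/seteqP: wz => [_ /(_ z)]; apply; exact: lexx.
Qed.

Variable l : seq G.
Hypotheses (Ml : M = nat_span l).
Hypothesis ptd : forall x y, M x -> M y -> x + y = 0 -> x = 0.

Lemma divides_locally_finite : locally_finite P.
Proof.
move=> x y; have := @finite_divisors _ l (g y); rewrite -Ml => /(_ ptd) fin.
apply: (@sub_finite_set _ _ (g @^-1` [set z | M z /\ M (g y - z)])).
  move=> z /=; rewrite in_itv /= => /andP[_ zy]; split=> //.
  by apply/le_divides.
by apply: finite_preimage fin => u v _ _; apply: g_inj.
Qed.

Lemma divides_finitely_many_atoms : finitely_many_atoms P.
Proof.
have [M0 MD] := subM; have [e ge] := gP M0.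
exists e; first exact: divides_minimum.
apply: (@sub_finite_set _ _ (g @^-1` [set` l])); last first.
  by apply: finite_preimage => [u v _ _|]; [apply: g_inj | exact: finite_seq].
move=> a [ae amin] /=.
have := gM a; rewrite {1}Ml => /nat_span_neq0[].
  by move=> ga0; apply: ae; apply: g_inj; rewrite ge.
move=> s ls [s0 [k lk aE]].
have [b gb] : exists b, g b = s by apply: gP; rewrite Ml; apply: mem_nat_span.
suff <- : b = a by rewrite gb.
apply: amin; first by move=> /= be; apply: s0; rewrite -gb be.
by apply/g_le; exists k; rewrite ?Ml // gb.
Qed.

End FromMonoid.

(** * The monoid law of an auto-equivalent poset *)

Section ToMonoid.
Context (d : Order.disp_t) (P : porderType d).

(** The law is [x + y := phi_x y], where [phi_x] is the member of [T] attached
to [x]. *)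
Lemma auto_equivalent_law (e : P) : global_minimum e -> auto_equivalent P ->
  exists add : P -> P -> P,
    [/\ associative add, commutative add, left_id e add, right_injective add
      & forall x y, (x <= y)%O <-> exists m, add x m = y].
Proof.
move=> emin [_ [T [[Tendo Tid Tcomp Tcomm] Tex]]].
have itvE (z : P) : `[z, +oo[%classic = [set x | (z <= x)%O].
  by apply/seteqP; split=> x; rewrite /= in_itv /= andbT.
have /choice[phi phiP] := Tex.
have phiT x : T (phi x) by case: (phiP x) => -[].
have phi_range x y : (x <= y)%O <-> exists m, phi x m = y.
  have [[_ + _] _] := phiP x; rewrite itvE => R.
  have -> : (x <= y)%O <-> range (phi x) y by rewrite R.
  by split=> [[m _ <-]|[m <-]]; exists m.
have phi_mono x : {mono phi x : u v / (u <= v)%O}.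
  by case: (phiP x) => -[_ _ []].
have phi_inj x : injective (phi x) by exact: inc_inj (phi_mono x).
(* Among the order embeddings in T, phi x is identified by its range. *)
have phi_uniq x f : T f -> {mono f : u v / (u <= v)%O} ->
    (forall y, (x <= y)%O <-> exists m, f m = y) -> phi x = f.
  move=> Tf fmono fr; have [_] := phiP x; apply.
  have R : range f = [set y | (x <= y)%O].
    apply/seteqP; split=> [_ [m _ <-]|y /fr[m <-]]; last by exists m.
    by apply/fr; exists m.
  rewrite itvE; split=> //; split=> //; split.
  - by move=> m _; rewrite -R; exists m.
  - by move=> u v _ _; apply: inc_inj.
  - by rewrite -R.
have phiD x y : phi (phi x y) = phi x \o phi y.
  apply: phi_uniq; first exact: Tcomp.
    by move=> u v; rewrite /= !phi_mono.
  move=> z; split=> [xyz|[m <-]]; last first.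
    by rewrite /= phi_mono; apply/phi_range; exists m.
  have /phi_range[w wz] : (x <= z)%O.
    by apply: le_trans xyz; apply/phi_range; exists y.
  move: xyz; rewrite -wz phi_mono => /phi_range[m <-].
  by exists m.
have phie : phi e = id.
  by apply: phi_uniq => // y; split=> _ //; exists y.
have phie_r x : phi x e = x.
  apply: le_anti; apply/andP; split; last by apply/phi_range; exists e.
  have /phi_range[m {2}<-] := lexx x.
  by rewrite phi_mono.
(* Commutativity of T, evaluated at the neutral element e. *)
have phiC x y : phi x y = phi y x.
  have := congr1 (@^~ e) (Tcomm _ _ (phiT x) (phiT y)).
  by rewrite /= !phie_r.
exists phi; split=> //.
- by move=> x y z; rewrite phiD.
- by move=> x; rewrite phie.
Qed.

End ToMonoid.

Section OrderedMonoid.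
Context (d : Order.disp_t) (P : porderType d).
Variables (e : P).
Hypotheses (emin : global_minimum e) (fin : locally_finite P).

(** Below any element there are finitely many others, so [<] is
well-founded. *)
Lemma locally_finite_ind (Q : P -> Prop) :
  (forall x, (forall y, (y < x)%O -> Q y) -> Q x) -> forall x, Q x.
Proof.
move=> QP x; have /finite_seqP[r rE] := fin e x.
have {rE} : forall z, (z <= x)%O -> z \in r.
  by move=> z zx; move/seteqP: rE => [+ _]; apply; rewrite /= in_itv /= emin.
have [n] := ubnP (size r); elim: n x r => // n IH x r /ltnSE rn xr.
apply: QP => y yx; apply: (IH y [seq z <- r | z != x]) => [|z zy].
  apply: leq_trans rn; rewrite size_filter -(count_predC (pred1 x) r).
  by rewrite -[X in (X < _)%N]add0n ltn_add2r -has_count has_pred1 xr.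
have zx := le_lt_trans zy yx.
by rewrite mem_filter (lt_eqF zx) xr // ltW.
Qed.

Lemma exists_atom_le x : x <> e -> exists2 a, atoms e a & (a <= x)%O.
Proof.
elim/locally_finite_ind: x => x IH xe.
have [[b [be bx]]|nb] := pselect (exists b, b <> e /\ (b < x)%O).
  by have [a aat ab] := IH b bx be; exists a => //; apply: le_trans (ltW bx).
exists x => //; split=> // b be; rewrite le_eqVlt => /predU1P[//|bx].
by case: nb; exists b.
Qed.

Lemma atoms_generate (G : zmodType) (M : set G) (g : P -> G) :
  injective g -> g e = 0 ->
  (forall x y, (x <= y)%O <-> exists m, g x + g m = g y) ->
  submonoid M -> (forall a, atoms e a -> M (g a)) -> forall x, M (g x).
Proof.
move=> g_inj ge g_le [M0 MD] Ma; elim/locally_finite_ind => x IH.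
have [->|/eqP xe] := eqVneq x e; first by rewrite ge.
have [a aat /g_le[y yE]] := exists_atom_le xe.
rewrite -yE; apply: MD; first exact: Ma.
apply: IH; rewrite lt_neqAle; apply/andP; split; last first.
  by apply/g_le; exists a; rewrite addrC.
(* If y = x then a = e, which is not an atom. *)
apply/eqP => yx; case: aat => ae _; apply: ae; apply: g_inj.
by apply: (addIr (g x)); rewrite ge add0r -{1}yx.
Qed.

End OrderedMonoid.

Theorem theorem6p3 (d : Order.disp_t) (P : porderType d) :
  (exists (G : zmodType) (M : set G),
     [/\ submonoid M, finitely_generated M, pointed M & isomorphic_to_P P M])
  <-> [/\ auto_equivalent P, locally_finite P & finitely_many_atoms P].
Proof.
split=> [[G [M [subM [S finS MS] /(pointedP subM) ptd]]]|].
  have /finite_seqP[l Sl] := finS; rewrite Sl submonoid_closureE in MS.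
  move=> /isomorphic_to_PP[g [g_inj gM g_le]]; split.
  - exact: (divides_auto_equivalent subM g_inj gM g_le).
  - exact: (divides_locally_finite g_inj gM g_le MS ptd).
  - exact: (divides_finitely_many_atoms subM g_inj gM g_le MS).
move=> [autoP finP [e emin fin_atoms]].
have [add [addA addC add0 addI add_le]] := auto_equivalent_law emin autoP.
pose N : nmodType := HB.pack (P : Type) (Choice.on P)
  (GRing.isNmodule.Build P addA addC add0).
pose g : P -> grothendieck N := @embed N.
have g_inj : injective g by exact: (@embed_inj N).
have gD x y : g (add x y) = g x + g y by exact: (@embedD N).
have ge : g e = 0 by exact: (@embed0 N).
have g_le x y : (x <= y)%O <-> exists m, g x + g m = g y.
  rewrite add_le; split=> -[m mE]; exists m; first by rewrite -gD mE.
  by apply: g_inj; rewrite gD.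
have subM : submonoid (range g).
  split=> [|_ _ [x _ <-] [y _ <-]]; first by exists e.
  by exists (add x y).
exists (grothendieck N), (range g); split=> //.
- exists (g @` atoms e); first exact: finite_image.
  apply/seteqP; split=> [_ [x _ <-]|].
    apply: (atoms_generate emin finP g_inj ge g_le); last first.
      by move=> a aat A [_]; apply; exists a.
    split=> [A [[]]//|u v Au Av A [AS sA]].
    by have [_ AD] := AS; apply: AD; [apply: Au | apply: Av].
  by apply: smallest_sub => // _ [a _ <-]; exists a.
- apply/pointedP => // _ _ [x _ <-] [y _ <-] xy.
  rewrite -ge; congr g; apply: le_anti; rewrite emin andbT.
  by apply/g_le; exists y; rewrite ge.
- apply/isomorphic_to_PP; exists g; split=> // x y; rewrite g_le.
  split=> [[m mE]|[_ [m _ <-] mE]]; last by exists m.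
  by exists (g m) => //; exists m.
Qed.
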